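(* Let $v>1$ be an integer, let $F$ be an absolutely continuous distribution function of a non-negative random variable $X$ with $E(X)<\infty$, and let $X_1,X_2,\dots$ be i.i.d. with distribution function $F$. Set $N=E\big(\max(X_1,\dots,X_v)-\min(X_1,\dots,X_v)\big)$ and $D=E\big(\max(X_1,\dots,X_v)+\min(X_1,\dots,X_v)\big)$. For $n\ge v$ let $$U_1=\binom{n}{v}^{-1}\sum_{1\le i_1<\cdots<i_v\le n}h_1(X_{i_1},\dots,X_{i_v}),\qquad U_2=\binom{n}{v}^{-1}\sum_{1\le i_1<\cdots<i_v\le n}h_2(X_{i_1},\dots,X_{i_v}),$$ where $h_1(x_1,\dots,x_v)=\max(x_1,\dots,x_v)-\min(x_1,\dots,x_v)$ and $h_2(x_1,\dots,x_v)=\max(x_1,\dots,x_v)+\min(x_1,\dots,x_v)$. Then, as $n\to\infty$, $U_1$ and $U_2$ are consistent estimators of $N$ and $D$, respectively.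
   Context: ''Consistent'' means convergence in probability to the estimated quantity as $n\to\infty$. *)

(* Defs.v *)
From HB Require Import structures.
From mathcomp Require Import all_boot all_order all_algebra.
From mathcomp Require Import finmap.
From mathcomp Require Import all_classical all_reals all_analysis.

Set Implicit Arguments.
Unset Strict Implicit.
Unset Printing Implicit Defensive.

Import Order.TTheory GRing.Theory Num.Theory.
Import numFieldNormedType.Exports.

Local Open Scope classical_set_scope.
Local Open Scope ring_scope.

(* The usual epsilon-delta absolute continuity, on the whole real line. A finite
   family of non-overlapping intervals ]p.1, p.2[ is listed in any order. *)
Definition abs_continuous (R : realType) (F : R -> R) : Prop :=
  forall eps : R, 0 < eps -> exists2 delta : R, 0 < delta &
    forall s : seq (R * R),
      all (fun p => p.1 <= p.2) s ->
      pairwise (fun p q => (p.2 <= q.1) || (q.2 <= p.1)) s ->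
      \sum_(p <- s) (p.2 - p.1) < delta ->
      \sum_(p <- s) `|F p.2 - F p.1| < eps.

Definition mutually_independent (d : measure_display) (T : measurableType d)
    (R : realType) (P : probability T R) (I : choiceType)
    (X : I -> {RV P >-> R}) : Prop :=
  forall (J : {fset I}) (A : I -> set R), (forall i, measurable (A i)) ->
    P (\bigcap_(i in [set` J]) (X i @^-1` A i)) =
    (\prod_(i <- J) P (X i @^-1` A i))%E.

(* The default values [head 0 x] only serve to start the fold: for a nonempty
   tuple they are entries of [x], so these are the largest and smallest entry. *)
Definition tuple_max (R : realType) (v : nat) (x : v.-tuple R) : R :=
  \big[Num.max/head 0 x]_(y <- x) y.

Definition tuple_min (R : realType) (v : nat) (x : v.-tuple R) : R :=
  \big[Num.min/head 0 x]_(y <- x) y.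

Definition h1 (R : realType) (v : nat) (x : v.-tuple R) : R :=
  tuple_max x - tuple_min x.

Definition h2 (R : realType) (v : nat) (x : v.-tuple R) : R :=
  tuple_max x + tuple_min x.

(* Indices start at 0, so the sample of size n is x 0, ..., x (n - 1). For
   n < v the sum is empty and the value is 0. *)
Definition Ustat (R : realType) (v : nat) (h : v.-tuple R -> R)
    (x : nat -> R) (n : nat) : R :=
  ('C(n, v)%:R)^-1 *
  \sum_(i : v.-tuple 'I_n | sorted (fun a b : 'I_n => (a < b)%N) i)
     h [tuple of [seq x j | j : 'I_n <- i]].

(* Convergence in probability to a constant. The constant is extended-real so
   that it can be an expectation; if it were infinite the distance would be
   +oo everywhere, so this property entails that it is finite. *)
Definition consistent (d : measure_display) (T : measurableType d)
    (R : realType) (P : probability T R) (Y : nat -> T -> R)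
    (theta : \bar R) : Prop :=
  forall eps : R, 0 < eps ->
    P [set w | (eps%:E <= `|(Y n w)%:E - theta|)%E] @[n --> \oo] --> 0%E.

(* Main.v *)
Require Import Defs.
From HB Require Import structures.
From mathcomp Require Import all_boot all_order all_algebra.
From mathcomp Require Import finmap ring lra.
From mathcomp Require Import all_classical all_reals all_analysis.
From mathcomp Require Import measurable_realfun.

Set Implicit Arguments.
Unset Strict Implicit.
Unset Printing Implicit Defensive.

Import Order.TTheory GRing.Theory Num.Theory.
Import numFieldNormedType.Exports.

Local Open Scope classical_set_scope.
Local Open Scope ring_scope.

(* Both U-statistics converge in L1, so Markov's inequality gives consistency;
   it suffices to treat the kernels max and min. Write each of them, at
   nonnegative arguments, as the integral over t >= 0 of 1[t < g x] (layer
   cake). The event t < max x is the complement of "all x_j <= t", and t < min x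
   is "all t < x_j", so at level t the U-statistic of the indicator is
   G = C(S, v) / C(n, v), or 1 - G, where S counts the exceedances of t (or
   their complements) in the sample, and its mean is p^v, or 1 - p^v. By Tonelli
   the L1 error is at most the integral over t of E|G - p^v|. For fixed t this
   tends to 0, because C(S, v) / C(n, v) is close to (S / n)^v and S / n has
   variance at most 1 / n by pairwise independence; and it is dominated by
   2 v F(t) (1 - F(t)), which is integrable since E X is finite. *)

(** * Products of numbers in [0, 1] and ratios of binomials *)

(** The factors are exchanged one at a time; the remaining ones lie in [0, 1] and cannot enlarge the
    difference. *)
Lemma ler_norm_prodB (R : realDomainType) (I : Type) (s : seq I) (a b : I -> R) :
  (forall i, 0 <= a i <= 1) -> (forall i, 0 <= b i <= 1) ->
  `|\prod_(i <- s) a i - \prod_(i <- s) b i| <= \sum_(i <- s) `|a i - b i|.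
Proof.
move=> a01 b01; elim: s => [|i s IHs]; first by rewrite !big_nil subrr normr0.
rewrite !big_cons.
have /andP[a0 a1] := a01 i.
have -> : a i * \prod_(j <- s) a j - b i * \prod_(j <- s) b j =
  a i * (\prod_(j <- s) a j - \prod_(j <- s) b j) +
  (a i - b i) * \prod_(j <- s) b j by ring.
have B : 0 <= \prod_(j <- s) b j <= 1.
  apply/andP; split; first by apply: prodr_ge0 => j _; case/andP: (b01 j).
  by apply: prodr_ile1 => j _.
case/andP: B => B0 B1.
rewrite (le_trans (ler_normD _ _))// addrC !normrM (ger0_norm a0) (ger0_norm B0).
by rewrite lerD// ?ler_piMr// (le_trans _ IHs)// ler_piMl.
Qed.

(** A strictly increasing tuple is determined by its set of entries, so these tuples correspond to
    the [v]-element subsets of [B]. *)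
Lemma card_ltn_sorted_tuples_in (v n : nat) (B : {set 'I_n}) :
  #|[set t : v.-tuple 'I_n | sorted ltn (map val t) & all (mem B) t]%SET| =
  'C(#|B|, v).
Proof.
pose f_t (t : v.-tuple 'I_n) := [set i in t]%SET.
pose T := [set t : v.-tuple 'I_n | sorted ltn (map val t) & all (mem B) t]%SET.
have injf : {in T &, injective f_t}.
  move=> t u; rewrite !inE => /andP[st _] /andP[su _] /setP ftu.
  apply/val_inj/(inj_map val_inj)/(irr_sorted_eq ltn_trans ltnn) => //= i.
  by apply/mapP/mapP => -[j jt ->]; exists j => //; move: (ftu j);
    rewrite !inE jt => // ->.
rewrite -cards_draws -(card_in_imset injf); apply: eq_card => A.
rewrite inE; apply/imsetP/andP => [[t]|[AB /eqP cA]].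
- rewrite inE => /andP[st /allP tB] ->; split.
    by apply/fintype.subsetP => i; rewrite inE => /tB.
  have ut : uniq t by rewrite -(map_inj_uniq val_inj) (sorted_uniq ltn_trans ltnn).
  by rewrite cardsE (card_uniqP ut) size_tuple.
- have sA : size (enum A) == v by rewrite -cardE cA.
  exists (Tuple sA); last by apply/setP => i; rewrite !inE /= mem_enum.
  rewrite inE /=; apply/andP; split; last first.
    by apply/allP => i; rewrite mem_enum => /(fintype.subsetP AB).
  (* The inverse map lists [A] by [enum A], which is increasing as a subsequence of the enumeration
     0, ..., n - 1. *)
  rewrite (subseq_sorted ltn_trans _ (iota_ltn_sorted 0 n))//.
  rewrite -val_enum_ord map_subseq// (_ : enum A = [seq i <- enum (ordinal n) | i \in A]) ?filter_subseq//.
  by rewrite enumT.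
Qed.

(** The kernel is 1 when [a] holds at every chosen index and 0 otherwise, so the sum counts
    increasing tuples inside the set of indices satisfying [a]. *)
Lemma Ustat_prod (R : realType) (v n : nat) (a : nat -> bool) :
  Ustat (fun x : v.-tuple R => \prod_(y <- x) y) (fun i => (a i)%:R) n =
  'C(\sum_(i < n) a i, v)%:R / 'C(n, v)%:R.
Proof.
rewrite /Ustat mulrC; congr (_ / _).
have -> : (\sum_(i < n) a i)%N = #|[set i : 'I_n | a i]%SET|.
  by rewrite -sum1dep_card [RHS]big_mkcond; apply: eq_bigr => i _; case: (a i).
rewrite -card_ltn_sorted_tuples_in -sum1_card natr_sum [RHS]big_mkcond.
rewrite [LHS]big_mkcond /=; apply: eq_bigr => t _.
rewrite !inE sorted_map; case: ifP => //= _.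
rewrite big_map; elim: {t}(val t) => [|i s IHs]; first by rewrite big_nil.
by rewrite big_cons IHs /= inE; case: (a i); rewrite ?mul1r ?mul0r.
Qed.

(* Both binomials are products of [v] factors; the [j]-th quotient is
   (s - j) / (n - j), within v / (n - v) of s / n. *)
Lemma bin_ratio_approx (R : realFieldType) (v n s : nat) (p : R) :
  (v < n)%N -> (s <= n)%N -> 0 <= p <= 1 ->
  `|'C(s, v)%:R / 'C(n, v)%:R - p ^+ v| <=
  v%:R * (`|s%:R / n%:R - p| + v%:R / (n - v)%:R).
Proof.
move=> vn sn p01.
have nj (j : 'I_v) : (j < n)%N by rewrite (ltn_trans _ vn).
have -> : 'C(s, v)%:R / 'C(n, v)%:R =
    \prod_(j < v) ((s - j)%:R / (n - j)%:R) :> R.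
  rewrite prodf_div -!natr_prod -!ffact_prod -!bin_ffact !natrM -mulf_div.
  by rewrite divff ?mulr1// pnatr_eq0 -lt0n fact_gt0.
have -> : p ^+ v = \prod_(j < v) p by rewrite prodr_const card_ord.
apply: (le_trans (ler_norm_prodB _ _ _)) => // [j|].
  rewrite divr_ge0//= ler_pdivrMr ?ltr0n ?subn_gt0// mul1r ler_nat.
  exact: leq_sub2r.
have -> (x : R) : v%:R * x = \sum_(j < v) x.
  by rewrite sumr_const card_ord mulr_natl.
apply: ler_sum => j _.
set q := s%:R / n%:R.
have -> : (s - j)%:R / (n - j)%:R - p = (q - p) + ((s - j)%:R / (n - j)%:R - q) by ring.
apply: (le_trans (ler_normD _ _)); rewrite lerD2l.
have n0 : 0 < n%:R :> R by rewrite ltr0n (leq_trans _ vn).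
have nj0 : 0 < (n - j)%:R :> R by rewrite ltr0n subn_gt0.
have nv0 : 0 < (n - v)%:R :> R by rewrite ltr0n subn_gt0.
apply: (@le_trans _ _ (j%:R / (n - j)%:R)); last first.
  apply: ler_pM; rewrite ?invr_ge0 ?ler0n//.
    by rewrite ler_nat; apply: ltnW.
  by rewrite lef_pV2 ?posrE// ler_nat; apply: leq_sub2l; apply: ltnW.
have nsr : s%:R <= n%:R :> R by rewrite ler_nat.
have j0 : 0 <= j%:R :> R by [].
rewrite distrC ler_norml; case: (leqP j s) => js.
  have -> : q - (s - j)%:R / (n - j)%:R =
     j%:R / (n - j)%:R * ((n%:R - s%:R) / n%:R) :> R.
    rewrite /q !natrB//; last by rewrite ltnW.
    by move: nj0; rewrite natrB ?(ltnW (nj j))// => nj0; field; rewrite !gt_eqF.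
  have z0 : 0 <= j%:R / (n - j)%:R :> R by rewrite divr_ge0.
  have x0 : 0 <= (n%:R - s%:R) / n%:R :> R by rewrite divr_ge0// ?subr_ge0// ltW.
  have x1 : (n%:R - s%:R) / n%:R <= 1 :> R.
    by rewrite ler_pdivrMr// mul1r gerBl.
  apply/andP; split; last exact: ler_piMr.
  by rewrite (@le_trans _ _ 0) ?oppr_le0// mulr_ge0.
(* For [s < j] the truncated subtraction yields 0, and [s / n] itself has to be at most
   [j / (n - j)]. *)
have -> : (s - j)%N = 0%N by apply/eqP; rewrite subn_eq0 ltnW.
rewrite mul0r subr0; apply/andP; split.
  by rewrite (@le_trans _ _ 0) ?oppr_le0 ?divr_ge0.
apply: ler_pM; rewrite ?invr_ge0 ?ler0n//.
  by rewrite ler_nat (ltnW js).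
by rewrite lef_pV2 ?posrE// ler_nat leq_subr.
Qed.

(** * Mean deviation of the frequency of pairwise independent events *)

Lemma bounded_integrable (d : measure_display) (T : measurableType d)
  (R : realType) (P : probability T R) (f : T -> R) (M : R) :
  measurable_fun setT f -> (forall w, `|f w| <= M) ->
  P.-integrable setT (EFin \o f).
Proof.
move=> mf fM.
apply: (le_integrable _ _ _ (finite_measure_integrable_cst P M measurableT)) => //.
- exact/measurable_EFinP.
- by move=> w _ /=; rewrite lee_fin (le_trans (fM w))// ler_norm.
Qed.

(** The integral is the covariance of the two indicators, whose means are both [p]. *)
Lemma integral_centered_indicM (d : measure_display) (T : measurableType d)
  (R : realType) (P : probability T R) (A B : set T) (p : R) :
  measurable A -> measurable B -> P A = p%:E -> P B = p%:E ->
  (\int[P]_w ((\1_A w - p) * (\1_B w - p))%:E = P (A `&` B) - (p * p)%:E)%E.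
Proof.
move=> mA mB PA PB.
have L (C : set T) : measurable C -> (\1_C : T -> R) \in Lfun P 1.
  by move=> mC; apply/Lfun1_integrable; exact: integrable_indic.
have EA : ('E_P[\1_A] = p%:E)%E by rewrite expectation_indic.
have EB : ('E_P[\1_B] = p%:E)%E by rewrite expectation_indic.
have AB : measurable (A `&` B) by exact: measurableI.
have EAB : ('E_P[\1_A * \1_B] = P (A `&` B))%E.
  by rewrite -[(\1_A * \1_B)%R]/(\1_A \* \1_B) -indicI expectation_indic.
have := covarianceE (L _ mA) (L _ mB).
rewrite -[X in (X \in _ -> _)]/(\1_A \* \1_B) -indicI => /(_ (L _ AB)).
by rewrite EAB EA EB covariance.unlock EA EB expectation.unlock.
Qed.

(* The second moment is at most 1/n, and |x| <= e + x^2/e with e = n^(-1/2). *)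
Lemma frequency_L1 (d : measure_display) (T : measurableType d)
  (R : realType) (P : probability T R) (A : nat -> set T) (p : R) (n : nat) :
  (0 < n)%N -> (forall i, measurable (A i)) -> (forall i, P (A i) = p%:E) ->
  (forall i j, i != j -> P (A i `&` A j) = (p * p)%:E) ->
  (\int[P]_w `|(\sum_(i < n) \1_(A i) w) / n%:R - p|%:E <=
   (2 / Num.sqrt n%:R)%:E)%E.
Proof.
move=> n0 mA PA PAA.
have nR : 0 < n%:R :> R by rewrite ltr0n.
set e := (Num.sqrt n%:R)^-1 : R.
have e0 : 0 < e by rewrite invr_gt0 sqrtr_gt0.
have e2 : e ^+ 2 = n%:R^-1 by rewrite exprVn sqr_sqrtr// ltW.
pose Y w := (\sum_(i < n) \1_(A i) w) / n%:R - p.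
have mI i : measurable_fun setT (\1_(A i) : T -> R) by exact: measurable_indic.
have mY : measurable_fun setT Y.
  apply: measurable_funB => //; apply: measurable_funM => //.
  exact: measurable_sum.
have p01 : 0 <= p <= 1.
  by rewrite -!lee_fin -(PA 0%N) measure_ge0 probability_le1.
have mf i j : measurable_fun setT (fun w => (\1_(A i) w - p) * (\1_(A j) w - p)).
  by apply: measurable_funM; apply: measurable_funB.
have V : (\int[P]_w (Y w ^+ 2)%:E <= (n%:R^-1)%:E)%E.
  have YE w : (Y w ^+ 2)%:E = ((n%:R ^- 2)%:E * \sum_(i < n) \sum_(j < n)
      ((\1_(A i) w - p) * (\1_(A j) w - p))%:E)%E.
    under eq_bigr do rewrite sumEFin.
    rewrite sumEFin -EFinM; congr EFin.
    have -> : Y w = n%:R^-1 * \sum_(i < n) (\1_(A i) w - p).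
      rewrite /Y big_split /= sumr_const card_ord -mulr_natr.
      by field; rewrite gt_eqF.
    rewrite exprMn exprVn; congr (_ * _); rewrite expr2 mulr_suml.
    by apply: eq_bigr => i _; rewrite mulr_sumr.
  have int_ij i j : P.-integrable setT
      (fun w => ((\1_(A i) w - p) * (\1_(A j) w - p))%:E).
    apply: (@bounded_integrable _ _ _ _ _ 1) => // w.
    have b k : `|\1_(A k) w - p| <= 1.
      case/andP: p01 => p0 p1; rewrite indicE.
      by case: (w \in A k) => /=; rewrite ler_norml; apply/andP; split; lra.
    by rewrite normrM mulr_ile1.
  under eq_integral do rewrite YE.
  rewrite integralZl//; last by apply: integrable_sum => // i _; apply: integrable_sum.
  rewrite integral_sum//; last by move=> i; apply: integrable_sum.
  (* Pairwise independence kills the covariances off the diagonal; each of the [n] diagonal terms is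
     [p - p * p]. *)
  under eq_bigr => i _.
    rewrite integral_sum// (bigD1 i)//= integral_centered_indicM// setIid PA.
    rewrite big1 ?adde0 -?EFinB; last first.
      by move=> j ji; rewrite integral_centered_indicM// PAA 1?eq_sym// subee.
    over.
  rewrite sumEFin -EFinM lee_fin sumr_const card_ord -(mulr_natr (p - p * p)).
  have -> : n%:R ^- 2 * ((p - p * p) * n%:R) = (p - p * p) / n%:R :> R.
    by field; rewrite gt_eqF.
  by rewrite ler_piMl ?invr_ge0 ?ltW//; nra.
apply: (@le_trans _ _ (\int[P]_w (e%:E + (e^-1)%:E * (Y w ^+ 2)%:E))%E).
  apply: ge0_le_integral => //.
  - by apply/measurable_EFinP; exact: measurableT_comp.
  - apply: emeasurable_funD => //; apply/measurable_EFinP.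
    by apply: measurable_funM => //; exact: measurable_funX.
  - move=> w _; rewrite -/(Y w) -EFinM -EFinD lee_fin -real_normK ?num_real//.
    rewrite -(ler_pM2l e0) mulrDr mulrA mulfV ?gt_eqF// mul1r.
    have := sqr_ge0 (e - `|Y w|); have := normr_ge0 (Y w); nra.
rewrite ge0_integralD//; last 3 first.
- by move=> w _; rewrite lee_fin ltW.
- by move=> w _; rewrite -EFinM lee_fin mulr_ge0 ?sqr_ge0// invr_ge0 ltW.
- apply: emeasurable_funM => //; apply/measurable_EFinP.
  exact: measurable_funX.
rewrite integral_cst//= probability_setT mule1 ge0_integralZl//; last 3 first.
- by apply/measurable_EFinP; exact: measurable_funX.
- by move=> w _; rewrite lee_fin sqr_ge0.
- by rewrite lee_fin invr_ge0 ltW.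
apply: (@le_trans _ _ (e%:E + (e^-1)%:E * (n%:R^-1)%:E)%E).
  by rewrite leeD2l// lee_wpmul2l// lee_fin invr_ge0 ltW.
(* Since 1/n = e^2, both summands equal [e]. *)
rewrite -EFinM -EFinD lee_fin -e2 expr2 mulrA mulVf ?gt_eqF// mul1r.
by rewrite -mulr2n mulr_natl.
Qed.

(** * Elementary properties of U-statistics *)

Lemma card_sorted_ord_tuples (v n : nat) :
  #|[pred i : v.-tuple 'I_n | sorted (fun a b : 'I_n => (a < b)%N) i]| = 'C(n, v).
Proof.
rewrite -card_ltn_sorted_tuples; apply: eq_card => i.
by rewrite !inE sorted_map.
Qed.

Lemma Ustat_cst (R : realType) (v : nat) (c : R) (x : nat -> R) (n : nat) :
  (v <= n)%N -> Ustat (fun _ : v.-tuple R => c) x n = c.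
Proof.
move=> vn; rewrite /Ustat (_ : \sum_(i | _) c = c *+ 'C(n, v)); last first.
  by rewrite -card_sorted_ord_tuples -sumr_const.
rewrite -(mulr_natr c) mulrCA mulVf ?mulr1//.
by rewrite pnatr_eq0 -lt0n bin_gt0.
Qed.

Lemma UstatD (R : realType) (v : nat) (g h : v.-tuple R -> R) (x : nat -> R)
  (n : nat) :
  Ustat (fun y => g y + h y) x n = Ustat g x n + Ustat h x n.
Proof. by rewrite /Ustat big_split mulrDr. Qed.

Lemma UstatB (R : realType) (v : nat) (g h : v.-tuple R -> R) (x : nat -> R)
  (n : nat) :
  Ustat (fun y => g y - h y) x n = Ustat g x n - Ustat h x n.
Proof. by rewrite /Ustat big_split sumrN mulrDr mulrN. Qed.

(** The hypothesis concerns the composites of [g] with sampled variables rather than [g] itself, so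
    no sigma-algebra on tuples enters. *)
Lemma measurable_Ustat (R : realType) (v : nat) (g : v.-tuple R -> R)
  (d : measure_display) (T : measurableType d) (X : nat -> T -> R) (n : nat) :
  (forall i : v.-tuple nat,
     measurable_fun setT (fun w => g [tuple of [seq X j w | j <- i]])) ->
  measurable_fun setT (fun w => Ustat g (fun i => X i w) n).
Proof.
move=> mg; apply: measurable_funM => //.
under eq_fun do rewrite big_mkcond.
apply: measurable_sum => i; case: (sorted _ i) => //.
have := mg [tuple of [seq val j | j <- i]].
congr (measurable_fun _ _); apply/funext => w; congr g.
by apply: val_inj; rewrite /= -map_comp.
Qed.

(** * L1 deviation of the U-statistic of indicators *)

(** The integrand is [1 - p] on [A] and [p] off [A], so each of the two pieces contributes
    [p * (1 - p)]. *)
Lemma integral_centered_indic_norm (d : measure_display) (T : measurableType d)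
  (R : realType) (P : probability T R) (A : set T) (p : R) :
  measurable A -> P A = p%:E -> 0 <= p <= 1 ->
  (\int[P]_w `|\1_A w - p|%:E = (2 * (p * (1 - p)))%:E)%E.
Proof.
move=> mA PA /andP[p0 p1].
have q0 : 0 <= 1 - p by rewrite subr_ge0.
have -> : (fun w => `|\1_A w - p|%:E) =
    (fun w => (1 - p)%:E * (\1_A w)%:E + p%:E * (\1_(~` A) w)%:E)%E.
  apply/funext => w; rewrite -!EFinM -EFinD !indicE in_setC; congr EFin.
  case: (w \in A) => /=; first by rewrite ger0_norm// !mulr1n; ring.
  by rewrite !mulr0n !mulr1n sub0r normrN ger0_norm//; ring.
have mC : measurable (~` A) by exact: measurableC.
have mI (B : set T) : measurable B -> measurable_fun setT (fun w => (\1_B w : R)%:E).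
  by move=> mB; apply/measurable_EFinP; exact: measurable_indic.
rewrite ge0_integralD//; last 4 first.
- by move=> w _; rewrite -EFinM lee_fin mulr_ge0.
- by apply: emeasurable_funM => //; exact: mI.
- by move=> w _; rewrite -EFinM lee_fin mulr_ge0.
- by apply: emeasurable_funM => //; exact: mI.
rewrite !ge0_integralZl//; [|exact: mI..].
rewrite !integral_indic// !setIT.
have PC : P (~` A) = (1 - p)%:E.
  by rewrite probability_setC// PA -EFinB.
rewrite [X in (_ * X + _)%E](_ : _ = p%:E)//.
rewrite [X in (_ + _ * X)%E](_ : _ = (1 - p)%:E)//.
by rewrite -!EFinM -EFinD; congr EFin; ring.
Qed.

(** With S the number of events that occur among the first [n], [bin_ratio_approx] bounds the
    integrand by the deviation of S / n from [p], whose mean is controlled by [frequency_L1]. *)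
Lemma Ustat_prod_indic_L1 (d : measure_display) (T : measurableType d)
  (R : realType) (P : probability T R) (A : nat -> set T) (p : R) (v n : nat) :
  (v < n)%N -> (forall i, measurable (A i)) -> (forall i, P (A i) = p%:E) ->
  (forall i j, i != j -> P (A i `&` A j) = (p * p)%:E) ->
  (\int[P]_w `|Ustat (fun x : v.-tuple R => \prod_(y <- x) y)
                 (fun i => \1_(A i) w) n - p ^+ v|%:E <=
   (v%:R * (2 / Num.sqrt n%:R + v%:R / (n - v)%:R))%:E)%E.
Proof.
move=> vn mA PA PAA.
have p01 : 0 <= p <= 1.
  by rewrite -!lee_fin -(PA 0%N) measure_ge0 probability_le1.
have mI i : measurable_fun setT (\1_(A i) : T -> R) by exact: measurable_indic.
pose Y w := (\sum_(i < n) \1_(A i) w) / n%:R - p.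
have mY : measurable_fun setT (fun w => `|Y w|).
  apply: measurableT_comp => //; apply: measurable_funB => //.
  by apply: measurable_funM => //; exact: measurable_sum.
pose c : R := v%:R / (n - v)%:R.
have c0 : 0 <= c by rewrite divr_ge0.
apply: (@le_trans _ _ (\int[P]_w (v%:R%:E * (`|Y w|%:E + c%:E)))%E).
  apply: ge0_le_integral => //.
  - apply/measurable_EFinP; apply: measurableT_comp => //.
    apply: measurable_funB => //; apply: measurable_Ustat => i.
    under eq_fun do rewrite big_map.
    by apply: measurable_prod => j _.
  - apply: emeasurable_funM => //; apply: emeasurable_funD => //.
    exact/measurable_EFinP.
  - move=> w _; rewrite -EFinD -EFinM lee_fin.
    have -> : (fun i => \1_(A i) w) = (fun i => (w \in A i)%:R : R).
      by apply/funext => i; rewrite indicE.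
    rewrite Ustat_prod /Y.
    have -> : \sum_(i < n) \1_(A i) w = (\sum_(i < n) (w \in A i))%N%:R :> R.
      by rewrite natr_sum; apply: eq_bigr => i _; rewrite indicE.
    apply: bin_ratio_approx => //.
    rewrite -[leqRHS]card_ord -sum1_card; apply: leq_sum => i _.
    by case: (w \in A i).
rewrite ge0_integralZl//; last 2 first.
- by apply: emeasurable_funD => //; exact/measurable_EFinP.
- by move=> w _; rewrite -EFinD lee_fin addr_ge0.
rewrite [leRHS]EFinM lee_wpmul2l// ?lee_fin// ge0_integralD//; last exact/measurable_EFinP.
rewrite integral_cst//= probability_setT mule1 EFinD leeD2r//.
by apply: frequency_L1 => //; exact: leq_trans vn.
Qed.

(** Each product of [v] indicators differs from [p ^+ v] by at most [v] deviations of mean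
    [2 * (p * (1 - p))]. The bound is uniform in [n] and small when [p] is near 0 or 1. *)
Lemma Ustat_prod_indic_dominated (d : measure_display) (T : measurableType d)
  (R : realType) (P : probability T R) (A : nat -> set T) (p : R) (v n : nat) :
  (v <= n)%N -> (forall i, measurable (A i)) -> (forall i, P (A i) = p%:E) ->
  (\int[P]_w `|Ustat (fun x : v.-tuple R => \prod_(y <- x) y)
                 (fun i => \1_(A i) w) n - p ^+ v|%:E <=
   (2 * v%:R * (p * (1 - p)))%:E)%E.
Proof.
move=> vn mA PA.
have p01 : 0 <= p <= 1.
  by rewrite -!lee_fin -(PA 0%N) measure_ge0 probability_le1.
have mI i : measurable_fun setT (\1_(A i) : T -> R) by exact: measurable_indic.
have mN i : measurable_fun setT (fun w => `|\1_(A i) w - p|%:E).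
  apply/measurable_EFinP; apply: measurableT_comp => //.
  exact: measurable_funB.
pose C : R := ('C(n, v)%:R)^-1.
have C0 : 0 <= C by rewrite invr_ge0.
have mS : measurable_fun setT (fun w =>
    (\sum_(i : v.-tuple 'I_n | sorted (fun a b : 'I_n => (a < b)%N) i)
       \sum_(j <- i) `|\1_(A j) w - p|%:E)%E).
  under eq_fun do rewrite big_mkcond; apply: emeasurable_sum => i.
  by case: (sorted _ i) => //; exact: emeasurable_sum.
apply: (@le_trans _ _ (\int[P]_w (C%:E *
  \sum_(i : v.-tuple 'I_n | sorted (fun a b : 'I_n => (a < b)%N) i)
     \sum_(j <- i) `|\1_(A j) w - p|%:E))%E).
  apply: ge0_le_integral => //.
  - apply/measurable_EFinP; apply: measurableT_comp => //.
    apply: measurable_funB => //; apply: measurable_Ustat => i.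
    under eq_fun do rewrite big_map.
    by apply: measurable_prod => j _.
  - exact: emeasurable_funM.
  - move=> w _.
    under eq_bigr do rewrite sumEFin.
    rewrite sumEFin -EFinM lee_fin.
    (* Writing [p ^+ v] as the U-statistic of a constant kernel lets the difference be estimated
       tuple by tuple. *)
    rewrite -(Ustat_cst (p ^+ v) (fun i => \1_(A i) w) vn) -UstatB /Ustat.
    rewrite normrM ger0_norm// ler_wpM2l// (le_trans (ler_norm_sum _ _ _))//.
    apply: ler_sum => i _; rewrite big_map.
    have -> : p ^+ v = \prod_(j <- i) p.
      by rewrite big_const_seq count_predT size_tuple iter_mulr_1.
    by apply: ler_norm_prodB => // j; rewrite indicE; case: (w \in A j); rewrite /= ler01 lexx.
rewrite ge0_integralZl//; last first.
  by move=> w _; apply: sume_ge0 => i _; exact: sume_ge0.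
under eq_integral do rewrite big_mkcond.
rewrite ge0_integral_sum//; last 2 first.
- by move=> i; case: (sorted _ i) => //; exact: emeasurable_sum.
- by move=> i w _; case: ifP => // _; exact: sume_ge0.
rewrite (eq_bigr (fun i : v.-tuple 'I_n =>
  if sorted (fun a b : 'I_n => (a < b)%N) i
  then (2 * v%:R * (p * (1 - p)))%:E else 0%E)); last first.
  move=> i _; case: (sorted _ i); last by rewrite integral0.
  rewrite ge0_integral_sum//.
  under eq_bigr do rewrite integral_centered_indic_norm//.
  rewrite sumEFin big_const_seq count_predT size_tuple iter_addr_0 -mulr_natr.
  by congr EFin; ring.
rewrite -big_mkcond/= sumEFin -EFinM lee_fin.
by rewrite -[X in X <= _]/(Ustat (fun _ : v.-tuple R => _) (fun=> 0) n) Ustat_cst.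
Qed.

Lemma ge0_integrable (d : measure_display) (T : measurableType d)
  (R : realType) (mu : {measure set T -> \bar R}) (D : set T) (f : T -> R) :
  measurable D -> measurable_fun setT f -> (forall x, 0 <= f x) ->
  (\int[mu]_(x in D) (f x)%:E < +oo)%E -> mu.-integrable D (EFin \o f).
Proof.
move=> mD mf f0 foo; apply/integrableP; split.
  by apply: measurable_funTS; exact/measurable_EFinP.
rewrite (eq_integral (EFin \o f))// => x _.
by rewrite /= ger0_norm.
Qed.

(** The shift by [v.+1] turns [n - v] into [n + 1], which never vanishes. *)
Lemma cvg_L1_bound (R : realType) (v : nat) :
  v%:R * (2 / Num.sqrt (n + v.+1)%:R + v%:R / (n + v.+1 - v)%:R) @[n --> \oo]
  --> (0 : R).
Proof.
have c1 : (n + v.+1)%:R^-1 @[n --> \oo] --> (0 : R).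
  have := @cvg_harmonic R; rewrite -(cvg_shiftn v).
  by under eq_fun do rewrite /harmonic/= -addnS.
have c2 : (n + v.+1 - v)%:R^-1 @[n --> \oo] --> (0 : R).
  rewrite (_ : (fun n => _) = @harmonic R); first exact: cvg_harmonic.
  by apply/funext => n; rewrite /harmonic/= -addSnnS addnK.
have c3 : (Num.sqrt (n + v.+1)%:R)^-1 @[n --> \oo] --> (0 : R).
  under eq_fun do rewrite -sqrtrV//.
  rewrite -[0](@sqrtr0 R).
  by apply: continuous_cvg; [exact: sqrt_continuous|exact: c1].
rewrite -[X in _ --> X](mulr0 v%:R); apply: cvgM; first exact: cvg_cst.
rewrite -[X in _ --> X]addr0 -[X in _ --> X + _](mulr0 2) -[X in _ --> _ + X](mulr0 v%:R).
by apply: cvgD; apply: cvgM => //; exact: cvg_cst.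
Qed.

(** * Maximum and minimum through comparison with a level *)

Lemma mem_head_tuple (T : eqType) (v : nat) (x0 : T) (x : v.-tuple T) :
  (0 < v)%N -> head x0 x \in x.
Proof. by case: v x => [|v] // /tupleP[y x] _; rewrite mem_head. Qed.

(** Xor with [true] turns [t < _] into [_ <= t]. Stated with a boolean summand, maximum and minimum
    satisfy one common hypothesis, so a single argument serves both. *)
Lemma lt_tuple_max (R : realType) (v : nat) (x : v.-tuple R) (t : R) :
  (0 < v)%N -> (t < tuple_max x) (+) true = all (fun y => (t < y) (+) true) x.
Proof.
have max_le (x0 : R) (s : seq R) : (t < \big[Num.max/x0]_(y <- s) y) (+) true =
    all (fun y => (t < y) (+) true) (x0 :: s).
  elim: s => [|y s IHs] /=; first by rewrite big_nil andbT.
  by rewrite big_cons lt_max addbT negb_or -[X in _ && X = _]addbT IHs/= !addbT andbCA.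
move=> v0; rewrite /tuple_max max_le.
(* The starting value [head 0 x] of the fold is an entry of [x], hence imposes no extra
   condition. *)
by rewrite /= andb_idl// => /allP; apply; exact: mem_head_tuple.
Qed.

Lemma lt_tuple_min (R : realType) (v : nat) (x : v.-tuple R) (t : R) :
  (0 < v)%N -> (t < tuple_min x) (+) false = all (fun y => (t < y) (+) false) x.
Proof.
have lt_min_all (x0 : R) (s : seq R) : (t < \big[Num.min/x0]_(y <- s) y) (+) false =
    all (fun y => (t < y) (+) false) (x0 :: s).
  elim: s => [|y s IHs] /=; first by rewrite big_nil andbT.
  by rewrite big_cons lt_min addbF -[X in _ && X = _]addbF IHs/= !addbF andbCA.
move=> v0; rewrite /tuple_min lt_min_all.
by rewrite /= andb_idl// => /allP; apply; exact: mem_head_tuple.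
Qed.

(** The real-valued counterpart of xor with [b]: passage to the complement for indicators and
    probabilities. *)
Definition flip (R : realType) (b : bool) (x : R) : R := if b then 1 - x else x.

Lemma flipK (R : realType) (b : bool) : involutive (@flip R b).
Proof. by move=> x; rewrite /flip; case: b => //; rewrite subKr. Qed.

Lemma flip_addb (R : realType) (b c : bool) : (c (+) b)%:R = flip b c%:R :> R.
Proof. by case: b; case: c; rewrite /flip/= ?mulr0n ?mulr1n ?subr0 ?subrr. Qed.

Lemma normr_flipB (R : realType) (b : bool) (x y : R) :
  `|flip b x - flip b y| = `|x - y|.
Proof.
rewrite /flip; case: b => //.
by rewrite opprB addrC addrA subrK distrC.
Qed.

Lemma measurable_flip (R : realType) (b : bool) (d : measure_display)
  (T : measurableType d) (f : T -> R) :
  measurable_fun setT f -> measurable_fun setT (fun x => flip b (f x)).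
Proof. by move=> mf; rewrite /flip; case: b => //; exact: measurable_funB. Qed.

(** * Layer-cake representation of the U-statistic *)

Section layer_cake.
(* [b] is [true] for the maximum and [false] for the minimum. *)
Context (R : realType) (v : nat) (v0 : (0 < v)%N) (g : v.-tuple R -> R) (b : bool).
Context (hg : forall (x : v.-tuple R) (t : R),
  (t < g x) (+) b = all (fun y => (t < y) (+) b) x).

(* The U-statistic whose kernel is the indicator of [(t < g x) (+) b]. *)
Definition exceedance (x : nat -> R) (n : nat) (t : R) : R :=
  Ustat (fun y : v.-tuple R => \prod_(z <- y) z)
    (fun i => ((t < x i) (+) b)%:R) n.

(** Test [hg] at the level [g x]: the left side is [b], while for [g x < 0] all entries exceed this
    level and the right side would be [~~ b]. *)
Lemma kernel_ge0 (x : v.-tuple R) : all (fun y => 0 <= y) x -> 0 <= g x.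
Proof.
move=> /allP x0; rewrite leNgt; apply/negP => gx.
have := hg x (g x); rewrite ltxx /=.
have -> : all (fun y => (g x < y) (+) b) x = ~~ b.
  case: b hg => _; last first.
    by apply/allP => y /x0 y0; rewrite addbF (lt_le_trans gx).
  apply/negbTE/allPn; exists (head 0 x).
    exact: mem_head_tuple.
  rewrite addbT negbK (lt_le_trans gx)//; apply: x0.
  exact: mem_head_tuple.
by case: b.
Qed.

Lemma lt_kernel_prod (x : v.-tuple R) (t : R) :
  (t < g x)%R%:R = flip b (\prod_(z <- x) ((t < z) (+) b)%:R) :> R.
Proof.
have -> : \prod_(z <- x) ((t < z) (+) b)%:R = ((t < g x) (+) b)%:R :> R.
  rewrite hg; elim: {x}(val x) => [|z s IHs] /=; first by rewrite big_nil.
  by rewrite big_cons IHs; case: (_ (+) b); rewrite /= ?mul1r ?mul0r.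
by rewrite flip_addb flipK.
Qed.

(** For [v <= n] the U-statistic is a genuine average, so it commutes with [flip b]. *)
Lemma Ustat_lt_kernel (x : nat -> R) (n : nat) (t : R) : (v <= n)%N ->
  Ustat (fun y => (t < g y)%R%:R) x n = flip b (exceedance x n t).
Proof.
move=> vn.
have E : Ustat (fun y : v.-tuple R => \prod_(z <- y) ((t < z) (+) b)%:R) x n = exceedance x n t.
  rewrite /exceedance /Ustat; congr (_ * _); apply: eq_bigr => i _.
  by rewrite !big_map.
have -> : (fun y => (t < g y)%R%:R) =
    (fun y => flip b (\prod_(z <- y) ((t < z) (+) b)%:R)) :> (v.-tuple R -> R).
  by apply/funext => y; exact: lt_kernel_prod.
rewrite /flip; case: b E => <- //.
by rewrite UstatB Ustat_cst.
Qed.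

Lemma integral_lt (z : R) : 0 <= z ->
  (\int[lebesgue_measure]_(t in `[0%R, +oo[) (t < z)%R%:R%:E = z%:E :> \bar R)%E.
Proof.
move=> z0.
transitivity (\int[@lebesgue_measure R]_(t in `[0%R, +oo[) (\1_`]-oo, z[ t)%:E)%E.
  by apply: eq_integral => t _; rewrite indicE mem_setE in_itv.
rewrite integral_indic// setIC -(set_itv_splitI `[0%R, z[)/= lebesgue_measure_itv/=.
by rewrite lte_fin; move: z0; rewrite le_eqVlt => /orP[/eqP <-|->]; rewrite ?ltxx ?sube0.
Qed.

(** Letting the level depend on [w] covers both measurability in the level alone and joint
    measurability in sample point and level. *)
Lemma measurable_exceedance (d : measure_display) (T : measurableType d)
  (x : nat -> T -> R) (t : T -> R) (n : nat) :
  (forall i, measurable_fun setT (x i)) -> measurable_fun setT t ->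
  measurable_fun setT (fun w => exceedance (fun i => x i w) n (t w)).
Proof.
move=> mx mt; apply: (@measurable_Ustat _ _ _ _ _
    (fun i w => ((t w < x i w) (+) b)%:R)) => i.
under eq_fun do rewrite big_map.
apply: measurable_prod => j _.
under eq_fun do rewrite flip_addb.
apply: measurable_flip.
apply: (measurableT_comp (f := fun c : bool => c%:R : R)) => //.
exact: measurable_fun_ltr.
Qed.

(** The finite sum is exchanged with the integral, and [integral_lt] applies to each kernel value,
    nonnegative by [kernel_ge0]. *)
Lemma Ustat_layer_cake (x : nat -> R) (n : nat) : (v <= n)%N ->
  (forall i, 0 <= x i) ->
  (\int[lebesgue_measure]_(t in `[0%R, +oo[) (flip b (exceedance x n t))%:E =
   (Ustat g x n)%:E)%E.
Proof.
move=> vn x0.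
under eq_integral do rewrite -Ustat_lt_kernel// /Ustat EFinM -sumEFin big_mkcond.
have mlt (z : R) : measurable_fun setT (fun t : R => ((t < z)%R%:R : R)%:E).
  apply/measurable_EFinP.
  apply: (measurableT_comp (f := fun c : bool => c%:R : R)) => //.
  exact: measurable_fun_ltr.
rewrite ge0_integralZl//; last 2 first.
- apply: measurable_funTS; apply: emeasurable_sum => i.
  by case: (sorted _ i); [exact: mlt|exact: measurable_cst].
- by move=> t _; apply: sume_ge0 => i _; case: ifP.
rewrite ge0_integral_sum//; last 2 first.
- by move=> i; apply: measurable_funTS; case: (sorted _ i);
  [exact: mlt|exact: measurable_cst].
- by move=> i t _; case: ifP.
rewrite /Ustat EFinM -sumEFin [in RHS]big_mkcond; congr (_ * _)%E.
apply: eq_bigr => i _; case: (sorted _ i); last exact: integral0.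
by apply: integral_lt; apply: kernel_ge0; apply/allP => _ /mapP[j _ ->].
Qed.

(** It suffices to treat the rays above [t], and the indicator of [t < g] is built from the
    indicators of [t < x i] by products and [flip]. *)
Lemma measurable_tuple_kernel (d : measure_display) (T : measurableType d)
  (x : 'I_v -> T -> R) : (forall i, measurable_fun setT (x i)) ->
  measurable_fun setT (fun w => g [tuple x i w | i < v]).
Proof.
move=> mx; apply: (measurability _ (RGenOInfty.measurableE R)) => //.
move=> _ [_ [t ->] <-]; rewrite setTI.
have -> : (fun w => g [tuple x i w | i < v]) @^-1` `]t, +oo[ =
  (fun w => flip b (\prod_(i < v) flip b (t < x i w)%R%:R) : R) @^-1` [set (1 : R)].
  apply/funext => w /=; rewrite in_itv/= andbT.
  have -> : flip b (\prod_(i < v) flip b (t < x i w)%R%:R) =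
      (t < g [tuple x i w | i < v])%R%:R :> R.
    rewrite lt_kernel_prod big_tuple; congr (flip b _).
    by apply: eq_bigr => i _; rewrite tnth_mktuple flip_addb.
  apply/propext; split => [->//|/eqP].
  by case: (t < _) => //; rewrite mulr0n eq_sym oner_eq0.
rewrite -[X in measurable X]setTI; apply: measurable_flip => //.
apply: measurable_prod => i _; apply: measurable_flip.
apply: (measurableT_comp (f := fun c : bool => c%:R : R)) => //.
exact: measurable_fun_ltr.
Qed.

Lemma measurable_Ustat_kernel (d : measure_display) (T : measurableType d)
  (x : nat -> T -> R) (n : nat) : (forall i, measurable_fun setT (x i)) ->
  measurable_fun setT (fun w => Ustat g (fun i => x i w) n).
Proof.
move=> mx; apply: measurable_Ustat => i.
have := measurable_tuple_kernel (fun j : 'I_v => mx (tnth i j)).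
congr (measurable_fun _ _); apply/funext => w; congr g.
by apply: eq_from_tnth => j; rewrite tnth_mktuple tnth_map.
Qed.

End layer_cake.

(** * Exceedance events of an i.i.d. sample *)

Section iid_exceedances.
Context (R : realType) (v : nat) (v0 : (0 < v)%N) (g : v.-tuple R -> R) (b : bool).
Context (hg : forall (x : v.-tuple R) (t : R),
  (t < g x) (+) b = all (fun y => (t < y) (+) b) x).
Context (d : measure_display) (T : measurableType d) (P : probability T R)
  (X : nat -> {RV P >-> R}) (F : R -> R).
Context (hXF : forall (i : nat) (r : R), cdf (X i) r = (F r)%:E)
  (hXind : mutually_independent X).

Let A (t : R) (i : nat) : set T := [set w | (t < X i w) (+) b].
(** The common probability of the events [A t i]: [F t] for the maximum and [1 - F t] for the
    minimum. *)
Let p (t : R) : R := flip (~~ b) (F t).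

Lemma cdf01 (t : R) : 0 <= F t <= 1.
Proof. by rewrite -!lee_fin -(hXF 0) cdf_ge0 cdf_le1. Qed.

Let ray (t : R) : set R := [set y | (t < y) (+) b].

Let rayE (t : R) : ray t = if b then [set` `]-oo, t]] else [set` `]t, +oo[].
Proof.
rewrite /ray; case: b; apply/funext => y /=; rewrite in_itv/=.
  by rewrite addbT -leNgt.
by rewrite addbF andbT.
Qed.

Let measurable_ray (t : R) : measurable (ray t).
Proof. by rewrite rayE; case: b => //; exact: measurable_itv. Qed.

Let mA (t : R) (i : nat) : measurable (A t i).
Proof. exact: (measurable_funPTI (X i) (measurable_ray t)). Qed.

Let PA (t : R) (i : nat) : P (A t i) = (p t)%:E.
Proof.
rewrite -[A t i]/(X i @^-1` ray t) rayE /p /flip; case: b => /=.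
  exact: hXF.
by have := ccdf_1_cdf (X i) t; rewrite hXF.
Qed.

Let P_bigcap (t : R) (J : {fset nat}) :
  P (\bigcap_(i in [set` J]) A t i) = (p t ^+ #|` J|)%:E.
Proof.
rewrite (hXind J (fun=> measurable_ray t)).
under eq_bigr do rewrite -[X in P X]/(A t _) PA.
rewrite prodEFin; congr EFin.
by rewrite big_const_seq count_predT iter_mulr_1.
Qed.

Let P_pair (t : R) (i j : nat) : i != j ->
  P (A t i `&` A t j) = (p t * p t)%:E.
Proof.
move=> ij; rewrite -expr2; have := P_bigcap t [fset i; j]%fset.
rewrite cardfs2 ij => <-; congr (P _).
apply/seteqP; split => [w [Ai Aj] k /=|w Aij].
  by rewrite !inE => /orP[] /eqP ->.
by split; apply: Aij => /=; rewrite !inE eqxx ?orbT.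
Qed.

(** By [hg] the event, or its complement when [b] is [true], is the joint occurrence of the first
    [v] events [A t i], which are independent. *)
Lemma prob_lt_kernel (t : R) :
  P [set w | t < g [tuple X i w | i < v]] = (flip b (p t ^+ v))%:E.
Proof.
have := P_bigcap t [fset i in iota 0 v]%fset.
have -> : (#|` [fset i in iota 0 v]| = v)%fset.
  by rewrite card_fseq undup_id ?iota_uniq// size_iota.
have -> : \bigcap_(i in [set` [fset i in iota 0 v]%fset]) A t i =
    [set w | (t < g [tuple X i w | i < v]) (+) b].
  apply/funext => w /=; rewrite hg; apply/propext; split.
    move=> Aw; apply/allP => _ /mapP[i _ ->]; apply: Aw => /=.
    by rewrite !inE mem_iota add0n /=.
  move=> /allP Aw i /=; rewrite !inE mem_iota add0n /= => iv.
  by apply: Aw; apply/mapP; exists (Ordinal iv); rewrite // mem_enum.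
set S := [set w | t < g _].
have mS : measurable S.
  have := measurable_tuple_kernel hg (fun i : 'I_v => measurable_funPT (X i)).
  move=> /(_ measurableT `]t, +oo[%classic (measurable_itv _)).
  rewrite setTI; congr (measurable _).
  by apply/funext => w /=; rewrite in_itv /= andbT.
rewrite /flip; case: b; last first.
  by move=> <-; congr (P _); apply/funext => w /=; rewrite addbF.
have -> : [set w | (t < g [tuple X i w | i < v]) (+) true] = ~` S.
  apply/funext => w /=; rewrite addbT; apply/propext.
  by split=> [/negP|tg]; [|apply/negP].
move=> E; rewrite EFinB -E -probability_setC ?setCK//.
exact: measurableC.
Qed.

Let exceedance_indic (w : T) (t : R) (n : nat) :
  exceedance v b (fun i => X i w) n t =
  Ustat (fun x : v.-tuple R => \prod_(y <- x) y) (fun i => \1_(A t i) w) n.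
Proof.
rewrite /exceedance; congr (Ustat _ _ _); apply/funext => i.
by rewrite indicE /A mem_setE.
Qed.

Lemma exceedance_L1 (t : R) (n : nat) : (v < n)%N ->
  (\int[P]_w `|exceedance v b (fun i => X i w) n t - p t ^+ v|%:E <=
   (v%:R * (2 / Num.sqrt n%:R + v%:R / (n - v)%:R))%:E)%E.
Proof.
move=> vn; under eq_integral do rewrite exceedance_indic.
exact: Ustat_prod_indic_L1 vn (mA t) (PA t) (@P_pair t).
Qed.

Lemma exceedance_dominated (t : R) (n : nat) : (v <= n)%N ->
  (\int[P]_w `|exceedance v b (fun i => X i w) n t - p t ^+ v|%:E <=
   (2 * v%:R * (F t * (1 - F t)))%:E)%E.
Proof.
move=> vn; under eq_integral do rewrite exceedance_indic.
have -> : F t * (1 - F t) = p t * (1 - p t).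
  by rewrite /p /flip; case: b => //=; rewrite subKr mulrC.
exact: Ustat_prod_indic_dominated vn (mA t) (PA t).
Qed.

(** * Tail and expectation of the kernel *)

(** By [prob_lt_kernel], the tail function of the kernel at the first [v] observations. *)
Let pi (t : R) : R := flip b (p t ^+ v).

Let pi_ge0 (t : R) : 0 <= pi t.
Proof. by rewrite -lee_fin -prob_lt_kernel measure_ge0. Qed.

(** Here [pi t] is the distance from [p t ^+ v] to [b%:R ^+ v], and [1 - F t] the distance from
    [p t] to [b%:R]; [ler_norm_prodB] compares the two. *)
Let pi_le (t : R) : pi t <= v%:R * (1 - F t).
Proof.
have /andP[F0 F1] := cdf01 t.
have p01 : 0 <= p t <= 1.
  by rewrite /p /flip; case: b => /=; rewrite ?F0 ?F1 ?subr_ge0 ?gerBl ?F1.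
have -> : pi t = `|p t ^+ v - b%:R ^+ v|.
  rewrite -(normr_flipB b) (_ : flip b (b%:R ^+ v) = 0) ?subr0 ?ger0_norm//.
    exact: pi_ge0.
  by rewrite /flip; case: b; rewrite /= ?expr1n ?subrr// expr0n eqn0Ngt v0.
have -> : 1 - F t = `|p t - b%:R|.
  rewrite /p /flip; case: b => /=; last by rewrite subr0 ger0_norm ?subr_ge0.
  by rewrite distrC ger0_norm ?subr_ge0.
have prodE (x : R) : x ^+ v = \prod_(i < v) x by rewrite prodr_const card_ord.
rewrite !prodE (le_trans (ler_norm_prodB _ _ _))// => [_|].
  by case: b; rewrite /= ler01 lexx.
by rewrite sumr_const card_ord mulr_natl.
Qed.

Let mF : measurable_fun setT F.
Proof.
apply/measurable_EFinP.
by have := cdf_measurable (X 0); congr (measurable_fun _ _); apply/funext => r /=.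
Qed.

Let mp : measurable_fun setT (fun t => p t ^+ v).
Proof. by apply: measurable_funX; exact: measurable_flip. Qed.

Let mpi : measurable_fun setT pi.
Proof. exact: measurable_flip. Qed.

(** Nonnegativity and finite mean, expressed through [F] alone so that they pass from any variable
    with this law to the sample. *)
Context (hF0 : forall t, t < 0 -> F t = 0)
  (hFint :
    (\int[@lebesgue_measure R]_(t in `[0%R, +oo[) (1 - F t)%:E < +oo)%E).

(** [F] vanishes strictly below 0, so the event [X i < 0] is covered by the countably many null
    events [X i <= - 1/(k + 1)]. *)
Let ae_ge0 : {ae P, forall w, forall i, 0 <= X i w}.
Proof.
apply: ae_foralln => i.
have neg : P.-negligible (\bigcup_k (X i @^-1` [set` `]-oo, (- k.+1%:R^-1)%R]])).
  apply: negligible_bigcup => k.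
  exists (X i @^-1` [set` `]-oo, (- k.+1%:R^-1)%R]]); split => //.
    by apply: measurable_funPTI; exact: measurable_itv.
  by have := hXF i (- k.+1%:R^-1); rewrite hF0// oppr_lt0 invr_gt0.
apply: negligibleS neg => w /= /negP; rewrite -ltNge => /ltr_add_invr[k Xk].
by exists k => //=; rewrite in_itv/= -subr_le0 opprK ltW.
Qed.

Let mu : {measure set _ -> \bar R} := @lebesgue_measure R.

Let mcompl : measurable_fun setT (fun t => 1 - F t).
Proof. exact: measurable_funB. Qed.

Let compl_ge0 (t : R) : 0 <= 1 - F t.
Proof. by have /andP[_ ?] := cdf01 t; rewrite subr_ge0. Qed.

Let integrable_le_tail (f : R -> R) (c : R) : measurable_fun setT f ->
  (forall t, 0 <= f t <= c * (1 - F t)) ->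
  mu.-integrable `[0%R, +oo[ (EFin \o f).
Proof.
move=> mf fc; have int1 : mu.-integrable `[0%R, +oo[ (fun t => (1 - F t)%:E).
  exact: (@ge0_integrable _ _ _ mu _ (fun t => 1 - F t)).
apply: (le_integrable _ _ _ (integrableZl _ c int1)) => //.
  by apply: measurable_funTS; exact/measurable_EFinP.
move=> t _ /=; have /andP[f0 fle] := fc t.
by rewrite lee_fin ger0_norm// (le_trans fle)// ler_norm.
Qed.

Let integrable_pi : mu.-integrable `[0%R, +oo[ (EFin \o pi).
Proof. by apply: (@integrable_le_tail _ v%:R) => // t; rewrite pi_ge0 pi_le. Qed.

Let M (w : T) : R := g [tuple X i w | i < v].

Let mM : measurable_fun setT M.
Proof. exact: (measurable_tuple_kernel hg (fun i : 'I_v => measurable_funPT (X i))). Qed.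

Let ae_M : {ae P, forall w, 0 <= M w}.
Proof.
apply: filterS ae_ge0 => w Xw; apply: (kernel_ge0 v0 hg).
by apply/allP => _ /mapP[i _ ->].
Qed.

Lemma expectation_kernel :
  P.-integrable setT (EFin \o M) /\
  (\int[P]_w (M w)%:E = \int[mu]_(t in `[0%R, +oo[) (pi t)%:E)%E.
Proof.
have mMp : measurable_fun setT (fun w => Num.max (M w) 0).
  (* The tail formula for expectations asks for nonnegativity everywhere, while [M] has it only
     almost everywhere; it is therefore applied to the positive part of [M]. *)
  exact: measurable_maxr.
pose Mp : {RV P >-> R} := HB.pack_for {mfun T >-> R} (fun w => Num.max (M w) 0)
  (isMeasurableFun.Build _ _ _ _ _ mMp).
have EMp : (\int[P]_w (Num.max (M w) 0)%:E =
    \int[mu]_(t in `[0%R, +oo[) (pi t)%:E)%E.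
  have := @ge0_expectation_ccdf _ _ _ P Mp.
  rewrite expectation.unlock => ->; last by move=> w; rewrite /= le_max lexx orbT.
  apply: eq_integral => t; rewrite inE/= in_itv/= andbT => t0.
  rewrite -prob_lt_kernel; congr (P _); apply/funext => w /=.
  by rewrite in_itv/= andbT lt_max [(t < 0)%R]ltNge t0 orbF.
have EM : ae_eq P setT (EFin \o M) (fun w => (Num.max (M w) 0)%:E).
  by apply: filterS ae_M => w Mw _; rewrite /= max_l.
split; last first.
  rewrite -EMp; apply: ae_eq_integral => //; exact/measurable_EFinP.
apply/integrableP; split; first exact/measurable_EFinP.
rewrite (_ : (\int[P]_w _)%E = \int[mu]_(t in `[0%R, +oo[) (pi t)%:E)%E.
  have /integrableP[_] := integrable_pi.
  congr (_ < _)%E; apply: eq_integral => t _.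
  by rewrite /= ger0_norm.
rewrite -EMp; apply: ae_eq_integral => //.
- by apply: measurableT_comp => //; exact/measurable_EFinP.
- exact/measurable_EFinP.
- by apply: filterS ae_M => w Mw _; rewrite /= max_l// ger0_norm.
Qed.

(** * L1 convergence of the U-statistic *)

Let theta : R := fine (\int[P]_w (M w)%:E)%E.

Let mD (n : nat) : measurable_fun setT (fun z : T * measurableTypeR R =>
  `|exceedance v b (fun i => X i z.1) n z.2 - p z.2 ^+ v|%:E).
Proof.
apply/measurable_EFinP; apply: measurableT_comp => //.
apply: measurable_funB; last exact: (measurableT_comp mp).
apply: (@measurable_exceedance _ _ _ _ (T * measurableTypeR R)%type
  (fun i z => X i z.1) snd) => // i.
exact: measurableT_comp.
Qed.

(** The U-statistic and [theta] are both integrals over levels; they are subtracted under the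
    integral, where [flip b] disappears from the absolute value. *)
Let ae_Ustat_le (n : nat) : (v <= n)%N ->
  {ae P, forall w, (`|Ustat g (fun i => X i w) n - theta|%:E <=
    \int[mu]_t `|exceedance v b (fun i => X i w) n t - p t ^+ v|%:E)%E}.
Proof.
move=> vn; apply: filterS ae_ge0 => w Xw.
have [_ EM] := expectation_kernel.
have thetaE : (theta%:E = \int[mu]_(t in `[0%R, +oo[) (pi t)%:E)%E.
  rewrite /theta EM fineK//.
  exact: integrable_fin_num integrable_pi.
have mG : measurable_fun setT (fun t : R => exceedance v b (fun i => X i w) n t).
  exact: (@measurable_exceedance _ _ _ _ _ (fun i _ => X i w) id).
have mfG : measurable_fun setT (fun t : R => flip b (exceedance v b (fun i => X i w) n t)).
  exact: measurable_flip.
have G0 t : 0 <= flip b (exceedance v b (fun i => X i w) n t).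
  rewrite -(Ustat_lt_kernel hg)// /Ustat mulr_ge0 ?invr_ge0//.
  by apply: sumr_ge0 => i _.
have lc := Ustat_layer_cake v0 hg vn Xw.
have iG : mu.-integrable `[0%R, +oo[
    (EFin \o (fun t => flip b (exceedance v b (fun i => X i w) n t))).
  by apply: ge0_integrable => //; rewrite lc ltry.
rewrite -[X in (X <= _)%E]/(`|(Ustat g (fun i => X i w) n - theta)%:E|)%E.
rewrite EFinB thetaE -lc -integralB_EFin//.
apply: (le_trans (le_abse_integral _ _ _)) => //.
  apply: measurable_funTS; apply: emeasurable_funB; exact/measurable_EFinP.
apply: (@le_trans _ _ (\int[mu]_(t in `[0%R, +oo[)
    `|exceedance v b (fun i => X i w) n t - p t ^+ v|%:E)%E).
  rewrite le_eqVlt; apply/orP; left; apply/eqP; apply: eq_integral => t _.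
  by rewrite -EFinB abse_EFin normr_flipB.
apply: ge0_subset_integral => //.
by apply/measurable_EFinP; apply: measurableT_comp => //; exact: measurable_funB.
Qed.

Lemma Ustat_L1_cvg :
  (\int[P]_w `|Ustat g (fun i => X i w) n - theta|%:E)%E @[n --> \oo] --> 0%E.
Proof.
pose u n : \bar R := (\int[P]_w `|Ustat g (fun i => X i w) n - theta|%:E)%E.
(* The shift makes every sample size exceed [v], as [exceedance_L1] requires. *)
suff : u (n + v.+1)%N @[n --> \oo] --> 0%E by rewrite (cvg_shiftn v.+1 u).
pose e n t : \bar R := (\int[P]_w
  `|exceedance v b (fun i => X i w) (n + v.+1) t - p t ^+ v|%:E)%E.
have vn n : (v < n + v.+1)%N by rewrite addnS ltnS leq_addl.
have mU n : measurable_fun setT (fun w => Ustat g (fun i => X i w) n).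
  exact: measurable_Ustat_kernel.
apply: (@squeeze_cvge _ _ _ _ (fun=> 0%E) _ (fun n => \int[mu]_t e n t)%E).
- near=> n; apply/andP; split; first exact: integral_ge0.
  rewrite /u /e -(fubini_tonelli (m1 := P) (m2 := mu) _ (mD _))//.
  apply: ae_ge0_le_integral => //.
  + by apply/measurable_EFinP; apply: measurableT_comp => //; exact: measurable_funB.
  + by move=> w _; exact: integral_ge0.
  + exact: (measurable_fun_fubini_tonelli_F (m2 := mu) _ (mD _)).
  + by apply: filterS (ae_Ustat_le (ltnW (vn n))) => w + _.
- exact: cvg_cst.
have -> : 0%E = (\int[mu]_t (fun=> 0) t)%E :> \bar R by rewrite integral0.
(* The bound of [exceedance_L1] tends to 0 but does not depend on the level, so it is not integrable
   over levels; [exceedance_dominated] supplies the dominating function. *)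
apply: (@dominated_cvg _ _ _ mu setT measurableT e (fun=> 0%E)
  (fun t => (2 * v%:R * (F t * (1 - F t)))%:E)) => //.
- by move=> n; exact: (measurable_fun_fubini_tonelli_G (m1 := P) _ (mD _)).
- move=> t _; apply: (@squeeze_cvge _ _ _ _ (fun=> 0%E) _ (fun n =>
    (v%:R * (2 / Num.sqrt (n + v.+1)%:R + v%:R / (n + v.+1 - v)%:R))%:E)%E).
  + apply: nearW => n; apply/andP; split; first exact: integral_ge0.
    exact: exceedance_L1.
  + exact: cvg_cst.
  + by apply: cvg_EFin; [exact: nearW|exact: cvg_L1_bound].
- have F01 t : 0 <= F t * (1 - F t).
    by have /andP[F0 F1] := cdf01 t; rewrite mulr_ge0 ?subr_ge0.
  apply: (ge0_integrable (mu := mu)) => //.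
  + by apply: measurable_funM => //; exact: measurable_funM.
  + by move=> t; rewrite mulr_ge0.
  (* As [F] vanishes below 0, only the half-line contributes, and there the function is at most
     [2 * v%:R * (1 - F t)]. *)
  + rewrite (_ : (\int[mu]_t _)%E = (\int[mu]_(t in `[0%R, +oo[)
        (2 * v%:R * (F t * (1 - F t)))%:E)%E); last first.
      rewrite [RHS]integral_mkcond; apply: eq_integral => t _.
      rewrite patchE mem_setE in_itv/= andbT; case: leP => // t0.
      by rewrite hF0// mul0r mulr0.
    rewrite ltey_eq; apply/orP; left; apply: integrable_fin_num => //.
    apply: (@integrable_le_tail _ (2 * v%:R)).
      apply: measurable_funM => //; exact: measurable_funM.
    move=> t; rewrite mulr_ge0//= ler_wpM2l// ler_piMl//.
    by have /andP[_ F1] := cdf01 t.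
- move=> n t _; rewrite gee0_abs; last exact: integral_ge0.
  by apply: exceedance_dominated; exact: ltnW.
Unshelve. all: by end_near.
Qed.

End iid_exceedances.

(** * From L1 convergence to consistency *)

Lemma consistent_L1 (d : measure_display) (T : measurableType d) (R : realType)
  (P : probability T R) (Y : nat -> T -> R) (theta : R) :
  (forall n, measurable_fun setT (Y n)) ->
  (\int[P]_w `|Y n w - theta|%:E)%E @[n --> \oo] --> 0%E ->
  consistent P Y theta%:E.
Proof.
move=> mY cY eps e0.
apply: (@squeeze_cvge _ _ _ _ (fun=> 0%E) _
  (fun n => (eps^-1)%:E * \int[P]_w `|Y n w - theta|%:E)%E).
- apply: nearW => n; rewrite measure_ge0 /=.
  have mYt : measurable_fun setT (fun w => (Y n w)%:E - theta%:E)%E.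
    by apply: emeasurable_funB => //; exact/measurable_EFinP.
  (* This is Markov's inequality. *)
  have := le_integral_abse P measurableT mYt e0; by rewrite setTI lee_pdivlMl.
- exact: cvg_cst.
- rewrite -[X in _ --> X](mule0 (eps^-1)%:E).
  by apply: cvgeZl.
Qed.

(** Serves both the difference and the sum of the two U-statistics: in either case the pointwise
    hypothesis is the triangle inequality. *)
Lemma cvg_L1_combine (d : measure_display) (T : measurableType d) (R : realType)
  (P : probability T R) (Y Z W : nat -> T -> R) (y z c : R) :
  (forall n, measurable_fun setT (Y n)) -> (forall n, measurable_fun setT (Z n)) ->
  (forall n, measurable_fun setT (W n)) ->
  (forall n w, `|W n w - c| <= `|Y n w - y| + `|Z n w - z|) ->
  (\int[P]_w `|Y n w - y|%:E)%E @[n --> \oo] --> 0%E ->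
  (\int[P]_w `|Z n w - z|%:E)%E @[n --> \oo] --> 0%E ->
  (\int[P]_w `|W n w - c|%:E)%E @[n --> \oo] --> 0%E.
Proof.
move=> mY mZ mW le cY cZ.
have mabs (f : T -> R) (r : R) : measurable_fun setT f ->
    measurable_fun setT (fun w => `|f w - r|%:E).
  move=> mf; apply/measurable_EFinP; apply: measurableT_comp => //.
  exact: measurable_funB.
apply: (@squeeze_cvge _ _ _ _ (fun=> 0%E) _ (fun n =>
  \int[P]_w `|Y n w - y|%:E + \int[P]_w `|Z n w - z|%:E)%E).
- apply: nearW => n; apply/andP; split; first exact: integral_ge0.
  rewrite -ge0_integralD//; [|exact: mabs..].
  apply: ge0_le_integral => //; first exact: mabs.
    by apply: emeasurable_funD; exact: mabs.
  by move=> w _; rewrite -EFinD lee_fin.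
- exact: cvg_cst.
- by rewrite -[X in _ --> X](adde0 0%E); apply: cvgeD.
Qed.

Theorem theorem1 (R : realType) (v : nat) (hv : (1 < v)%N)
  (F : R -> R) (hFac : abs_continuous F)
  (d0 : measure_display) (T0 : measurableType d0) (P0 : probability T0 R)
  (X0 : {RV P0 >-> R})
  (hX0F : forall r : R, cdf X0 r = (F r)%:E)
  (hX0ge0 : forall w : T0, 0 <= X0 w)
  (hX0fin : ('E_P0[X0] < +oo)%E)
  (d : measure_display) (T : measurableType d) (P : probability T R)
  (X : nat -> {RV P >-> R})
  (hXF : forall (i : nat) (r : R), cdf (X i) r = (F r)%:E)
  (hXind : mutually_independent X) :
  consistent P (fun n w => Ustat (@h1 R v) (fun i => X i w) n)
    'E_P[fun w => tuple_max [tuple X i w | i < v]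
                  - tuple_min [tuple X i w | i < v]]
  /\
  consistent P (fun n w => Ustat (@h2 R v) (fun i => X i w) n)
    'E_P[fun w => tuple_max [tuple X i w | i < v]
                  + tuple_min [tuple X i w | i < v]].
Proof.
have v0 : (0 < v)%N by exact: ltnW.
have F0 t : t < 0 -> F t = 0.
  move=> t0; apply: EFin_inj; rewrite -hX0F.
  rewrite -[RHS](measure0 P0); congr (P0 _); rewrite -subset0 => w /=.
  by rewrite in_itv/= leNgt (lt_le_trans t0).
(* The mean of [X0] is the integral of its tail [1 - F] over the half-line. *)
have Fint : (\int[@lebesgue_measure R]_(t in `[0%R, +oo[) (1 - F t)%:E < +oo)%E.
  move: hX0fin; rewrite ge0_expectation_ccdf//; congr (_ < _)%E.
  by apply: eq_integral => t _; rewrite ccdf_1_cdf hX0F.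
have mX i : measurable_fun setT (X i) by exact: measurable_funPT.
have hMx (x : v.-tuple R) t := lt_tuple_max x t v0.
have hMn (x : v.-tuple R) t := lt_tuple_min x t v0.
have mMx n := measurable_Ustat_kernel hMx n mX.
have mMn n := measurable_Ustat_kernel hMn n mX.
have cMx := Ustat_L1_cvg v0 hMx hXF hXind F0 Fint.
have cMn := Ustat_L1_cvg v0 hMn hXF hXind F0 Fint.
have [iMx _] := expectation_kernel v0 hMx hXF hXind F0 Fint.
have [iMn _] := expectation_kernel v0 hMn hXF hXind F0 Fint.
rewrite expectation.unlock; split.
(* Both kernels are integrable, so the expectation splits and each part is a real number, as
   [consistent_L1] requires. *)
- rewrite integralB_EFin// -(fineK (integrable_fin_num _ iMx))//.
  rewrite -(fineK (integrable_fin_num _ iMn))// -EFinB.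
  have m1 n : measurable_fun setT (fun w => Ustat (@h1 R v) (fun i => X i w) n).
    by under eq_fun do rewrite /h1 UstatB; exact: measurable_funB.
  apply: consistent_L1 => //; apply: (cvg_L1_combine mMx mMn m1 _ cMx cMn) => n w.
  rewrite /h1 UstatB (le_trans _ (ler_normB _ _))//.
  by rewrite le_eqVlt; apply/orP; left; apply/eqP; congr (`|_|); ring.
- rewrite integralD_EFin// -(fineK (integrable_fin_num _ iMx))//.
  rewrite -(fineK (integrable_fin_num _ iMn))// -EFinD.
  have m2 n : measurable_fun setT (fun w => Ustat (@h2 R v) (fun i => X i w) n).
    by under eq_fun do rewrite /h2 UstatD; exact: measurable_funD.
  apply: consistent_L1 => //; apply: (cvg_L1_combine mMx mMn m2 _ cMx cMn) => n w.
  rewrite /h2 UstatD (le_trans _ (ler_normD _ _))//.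
  by rewrite le_eqVlt; apply/orP; left; apply/eqP; congr (`|_|); ring.
Qed.
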